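(* Let $A$ be an $n\times n$ nonnegative matrix such that $A_{ii}>0$ for all $i\in[n]$. Then $\operatorname{per}(A)=\det(A)$ if and only if the following two statements hold: (1) for all distinct $i,j\in[n]$, $A_{ij}=0$ or $A_{ji}=0$; (2) the digraph $G(A)$ contains no cycle of even length.
   Context: $[n]=\{1,\dots,n\}$. A nonnegative matrix is a matrix whose entries are all nonnegative real numbers; $A_{ij}$ is its $(i,j)$-entry. $\operatorname{per}(A)=\sum_{\sigma\in S_n}\prod_{i=1}^n A_{i\sigma(i)}$ is the permanent. For an $n\times n$ matrix $A$, $G(A)$ is the digraph with vertex set $[n]$ and arc set $\{ij \mid A_{ij}\neq 0,\ i\neq j\}$ (the arc $ij$ goes from $i$ to $j$). A cycle of length $k$ in a digraph, where $k\ge 3$, is a directed closed walk $v_1v_2\cdots v_kv_1$ with $v_1,\dots,v_k$ distinct, where $v_iv_{i+1}$ ($1\le i\le k-1$) and $v_kv_1$ are arcs. *)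

(* Defs.v *)
From mathcomp Require Import all_boot all_order all_fingroup all_algebra.

Set Implicit Arguments.
Unset Strict Implicit.
Unset Printing Implicit Defensive.

Import GRing.Theory Num.Theory.
Local Open Scope ring_scope.

Definition permanent (R : comNzRingType) (n : nat) (A : 'M[R]_n) : R :=
  \sum_(s : 'S_n) \prod_(i < n) A i (s i).

Definition digraph_of (R : comNzRingType) (n : nat) (A : 'M[R]_n) : rel 'I_n :=
  fun i j => (A i j != 0) && (i != j).

(* The sequence [:: v_1; ...; v_k] stands for the closed walk
   v_1 v_2 ... v_k v_1: [ucycleb e c] says that the v_i are distinct, that
   each v_i v_(i+1) is an arc and that v_k v_1 is an arc.  The length of the
   cycle is k = size c, and closed walks of length at most 2 are excluded. *)
Definition dicycle (T : eqType) (e : rel T) (c : seq T) : bool :=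
  (3 <= size c)%N && ucycleb e c.

(* Main.v *)
Require Import Defs.
From mathcomp Require Import all_boot all_order all_fingroup all_algebra.

Import GRing.Theory Num.Theory.
Local Open Scope ring_scope.

(** The difference between the permanent and the determinant is twice the sum
    of the products over odd permutations, and these are all nonnegative.  An
    odd permutation has a cycle of even length, and conversely the cyclic
    permutation along an even cycle is odd; its product does not vanish since
    its fixed points contribute positive diagonal entries.  Condition (1)
    excludes the cycles of length 2. *)

(** Only the wrap-around value differs: [x] on the left, [y] inside the [tperm]. Every other value,
    an entry of [p] or the default [z], avoids [x] and [y]; the premise on [w] keeps [z = y] away
    from the default. *)
Lemma next_at_tperm (T : finType) (x y z w : T) (p : seq T) :
  z != x -> (z == y -> w = y) -> x \notin p -> y \notin p ->
  next_at z x w p = tperm x y (next_at z y w p).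
Proof.
move=> zx; elim: p w => [|u p IHp] w zyw /=.
  case: eqP => [_|/eqP zw _ _]; first by rewrite tpermR.
  rewrite tpermD // 1?eq_sym //.
  by apply: contra zw => zy; rewrite (zyw zy).
rewrite !inE !negb_or => /andP[xu xp] /andP[yu yp].
case: eqP => [_|/eqP zw]; first by rewrite tpermD // eq_sym.
by apply: IHp => // zy; case/eqP: zw; rewrite (zyw zy) (eqP zy).
Qed.

Lemma next_cons2 (T : finType) (x y z : T) (p : seq T) :
  uniq [:: x, y & p] -> next [:: x, y & p] z = tperm x y (next (y :: p) z).
Proof.
rewrite /= inE negb_or => /andP[/andP[xy xp] /andP[yp _]].
case: (eqVneq z x) => [->|zx]; last exact: next_at_tperm.
(* Off the cycle [next] is the identity, so [x] stays put and is then sent to [y]. *)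
rewrite -[next_at x y y p]/(next (y :: p) x) next_nth inE (negPf xy) (negPf xp).
by rewrite tpermL.
Qed.

(** Prepending an entry to a cycle composes it with one transposition, and a cycle of length 1 is
    the identity. *)
Lemma perm_next (T : finType) (x : T) (p : seq T) :
  uniq (x :: p) ->
  exists2 s : {perm T}, s =1 next (x :: p) & odd_perm s = odd (size p).
Proof.
elim: p x => [|y p IHp] x uxp.
  exists 1%g; last by rewrite odd_perm1.
  by move=> z; rewrite perm1 /=; case: eqP.
have /andP[] := uxp; rewrite inE negb_or => /andP[xy _] uyp.
have [s sE s_odd] := IHp y uyp.
exists (s * tperm x y)%g; first by move=> z; rewrite permM next_cons2 // sE.
by rewrite odd_permM odd_tperm xy s_odd addbT.
Qed.

(** The sign of [s] is the parity of [#|T|] plus the number of orbits. If all orbits had odd size,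
    these two numbers would have the same parity, as [#|T|] is the sum of the orbit sizes. *)
Lemma odd_perm_even_porbit (T : finType) (s : {perm T}) :
  odd_perm s -> exists x, ~~ odd #|porbit s x|.
Proof.
move=> s_odd; apply/existsP; apply: contraLR s_odd.
rewrite negb_exists => /forallP all_odd; rewrite /odd_perm.
have /card_partition : partition (porbits s) [set: T].
  have -> : porbits s = [set orbit 'P <[s]>%g x | x in [set: T]].
    by rewrite -porbitE; apply/setP=> B; apply/imsetP/imsetP => -[x _ ->];
      exists x.
  by apply/orbit_partition/actsP => g _ x; rewrite !inE.
rewrite cardsT => ->.
suff -> : odd (\sum_(B in porbits s) #|B|) = odd #|porbits s| by rewrite addbb.
rewrite -sum1_card !(big_morph odd oddD (erefl _)); apply: eq_bigr => B.
by move=> /imsetP[x _ ->]; have := all_odd x; rewrite negbK => ->.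
Qed.

Lemma fcycle_traject_porbit (T : finType) (s : {perm T}) (x : T) :
  fcycle s (traject s x #|porbit s x|).
Proof.
have := iter_porbit s x; case: #|_| => [//|k].
rewrite iterSr /= => iter_x.
by rewrite -{3}iter_x -trajectSr fpath_traject.
Qed.

Lemma permanent_eq_det (R : realFieldType) (n : nat) (A : 'M[R]_n) :
  (forall i j : 'I_n, 0 <= A i j) ->
  permanent A = \det A <->
  (forall s : 'S_n, odd_perm s -> exists i, A i (s i) = 0).
Proof.
move=> A_nneg.
have prod_ge0 (s : 'S_n) : 0 <= \prod_i A i (s i) by exact: prodr_ge0.
have diffE : permanent A - \det A =
    \sum_(s : 'S_n | odd_perm s) (\prod_i A i (s i)) *+ 2.
  rewrite /permanent /determinant -sumrB [RHS]big_mkcond; apply: eq_bigr => s _.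
  case: odd_perm; first by rewrite expr1 mulN1r opprK mulr2n.
  by rewrite expr0 mul1r subrr.
apply: (iff_trans (rwP eqP)).
rewrite -subr_eq0 diffE psumr_eq0 => [|s _]; last exact: mulrn_wge0.
split=> [/allP all0 s s_odd | all0].
  have := all0 s (mem_index_enum s); rewrite s_odd mulrn_eq0 /=.
  by move=> /prodf_eq0[i _ /eqP]; exists i.
apply/allP => s _; apply/implyP => /all0[i Ai0].
by rewrite (bigD1 i) //= Ai0 mul0r mul0rn.
Qed.

(** With [ucycleb] in place of [dicycle], length 2 is covered too, which is what condition (1)
    requires. *)
Lemma even_cycle_perm (R : realFieldType) (n : nat) (A : 'M[R]_n)
    (c : seq 'I_n) :
  (forall i : 'I_n, A i i != 0) -> c != [::] ->
  ucycleb (digraph_of A) c -> ~~ odd (size c) ->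
  exists2 s : 'S_n, odd_perm s & forall i, A i (s i) != 0.
Proof.
case: c => [//|x p] A_diag _ /andP[cyc_c uniq_c] /=; rewrite negbK => odd_p.
have [s sE s_odd] := perm_next _ _ _ uniq_c.
exists s => [|i]; first by rewrite s_odd.
(* On the cycle the entry belongs to an arc; elsewhere it is diagonal. *)
rewrite sE; have [/(next_cycle cyc_c)/andP[] // | ic] := boolP (i \in x :: p).
by rewrite next_nth (negPf ic).
Qed.

Lemma perm_even_cycle (R : realFieldType) (n : nat) (A : 'M[R]_n) (s : 'S_n) :
  odd_perm s -> (forall i, A i (s i) != 0) ->
  exists c : seq 'I_n,
    [/\ c != [::], ucycleb (digraph_of A) c & ~~ odd (size c)].
Proof.
move=> /(odd_perm_even_porbit _ _)[x x_even] A_s.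
(* The cycle runs once through an orbit of even size. *)
set c := traject s x #|porbit s x|.
have size_c : size c = #|porbit s x| by rewrite size_traject.
exists c; split; last by rewrite size_c.
- by rewrite -size_eq0 size_c card_porbit_neq0.
rewrite /ucycleb uniq_traject_porbit andbT.
apply: (sub_in_cycle (P := [in c]) _ _ (fcycle_traject_porbit _ s x));
  last exact/allP.
move=> i j ic _ /eqP <-; rewrite /digraph_of A_s /=.
(* Arcs exclude loops: a fixed point in the orbit would reduce it to one element, an odd size. *)
apply: contra x_even => /eqP fix_i.
have : i \in porbit s x by rewrite porbit_traject.
rewrite -eq_porbit_mem => /eqP <-.
suff -> : porbit s i = [set i] by rewrite cards1.
apply/setP => k; rewrite inE; apply/porbitP/eqP => [[m ->]|->].
  by rewrite permX; elim: m => //= m ->.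
by exists 0%N; rewrite expg0 perm1.
Qed.

Theorem theorem3p1 (R : realFieldType) (n : nat) (A : 'M[R]_n)
    (A_nneg : forall i j : 'I_n, 0 <= A i j)
    (A_diag : forall i : 'I_n, 0 < A i i) :
  permanent A = \det A <->
  (forall i j : 'I_n, i != j -> A i j = 0 \/ A j i = 0) /\
  ~ (exists c : seq 'I_n, dicycle (digraph_of A) c /\ ~~ odd (size c)).
Proof.
apply: (iff_trans (permanent_eq_det _ _ _ A_nneg)).
split=> [odd0 | [no2 no_even] s s_odd].
  (* Both conditions follow from this: (1) from the closed walk [[:: i; j]], (2) from longer
     cycles. *)
  have no_cycle c : c != [::] -> ucycleb (digraph_of A) c -> odd (size c).
    move=> c_neq0 cyc_c; apply/negPn/negP => even_c.
    have A_diag0 i : A i i != 0 by exact: lt0r_neq0.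
    have [s /odd0[i Ai0]] :=
      even_cycle_perm _ _ _ _ A_diag0 c_neq0 cyc_c even_c.
    by move/(_ i); rewrite Ai0 eqxx.
  split=> [i j ij | [c [/andP[c_ge3 cyc_c] /negP]]].
    have [|Aij] := eqVneq (A i j) 0; [by left | right].
    apply/eqP/negPn/negP => Aji; have := no_cycle [:: i; j] isT.
    by rewrite /ucycleb /= /digraph_of inE Aij Aji ij eq_sym ij => /(_ isT).
  by apply; apply: no_cycle => //; case: (c) c_ge3.
have [/existsP[i /eqP]|/existsPn A_s] := boolP [exists i, A i (s i) == 0].
  by exists i.
have [c [c_neq0 cyc_c even_c]] := perm_even_cycle _ _ _ _ s_odd A_s; exfalso.
have [c_ge3|] := leqP 3 (size c).
  by apply: no_even; exists c; split=> //; apply/andP.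
(* A nonempty cycle of even length below 3 has length 2, so two opposite entries are nonzero,
   against (1). *)
case: c c_neq0 cyc_c even_c => [|i [|j []]] //= _ /andP[].
rewrite /= /digraph_of andbT => /andP[/andP[Aij ij] /andP[Aji _]] _ _ _.
by case: (no2 i j ij) => A0; [move: Aij | move: Aji]; rewrite A0 eqxx.
Qed.
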